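(* Let $p$ be any prime and let $G=Q_{4p}$. (a) If $p=2$ then $E(\mathcal{B}(G))=2+14\sqrt{3}+4\sqrt{6}$, $LE(\mathcal{B}(G))=LE^+(\mathcal{B}(G))=\frac{4132}{35}$ and $E_{CN}(\mathcal{B}(G))=116$. (b) If $p\geq 3$ then $$E(\mathcal{B}(G))=2+2\sqrt{3}+2p\sqrt{12}+2\sqrt{p^2-1}+2\sqrt{3p^2-3}+2\sqrt{12p^2-12p},$$ $$LE(\mathcal{B}(G))=LE^+(\mathcal{B}(G))=\frac{512p^4+2p^2+20p+50}{16p^2+p+5},$$ and $$E_{CN}(\mathcal{B}(G))=32p^2-2p-10.$$
   Context: $Q_{4m}=\langle a,b : a^{2m}=1,\ b^2=a^m,\ bab^{-1}=a^{-1}\rangle$ is the dicyclic group of order $4m$. For a finite group $G$, let $L(G)$ be the set of all subgroups of $G$. The subgroup generating bipartite graph $\mathcal{B}(G)$ is the simple bipartite graph with vertex set the disjoint union of $G\times G$ and $L(G)$, in which $(a,b)\in G\times G$ and $H\in L(G)$ are adjacent if and only if $H$ is the subgroup generated by $a$ and $b$ (and there are no other edges). For a finite simple graph $\Gamma$ with $n$ vertices $v_1,\dots,v_n$ and $m$ edges, let $A$ be its adjacency matrix, $D$ its diagonal degree matrix, and $CN(\Gamma)$ the common neighborhood matrix, whose $(i,j)$ entry for $i\neq j$ is the number of vertices other than $v_i,v_j$ adjacent to both $v_i$ and $v_j$, with zero diagonal. The energy $E(\Gamma)$ and the common neighborhood energy $E_{CN}(\Gamma)$ are the sums of absolute values of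 the eigenvalues (with multiplicity) of $A$ and $CN(\Gamma)$ respectively. The Laplacian energy is $LE(\Gamma)=\sum_{\lambda}|\lambda-\frac{2m}{n}|$ over the eigenvalues $\lambda$ of $D-A$, and the signless Laplacian energy is $LE^+(\Gamma)=\sum_{\mu}|\mu-\frac{2m}{n}|$ over the eigenvalues $\mu$ of $D+A$ (both counted with multiplicity). *)

(* Defs.v *)
From HB Require Import structures.
From mathcomp Require Import all_boot all_order all_fingroup all_algebra.

Set Implicit Arguments.
Unset Strict Implicit.
Unset Printing Implicit Defensive.

Import Order.TTheory GRing.Theory Num.Theory.

(* [Grp] conjugation [x ^ y] is y^-1 x y, hence the explicit b a b^-1.
   The library's ['Q_n] is the dicyclic group only when n is a power of 2. *)
Definition is_dicyclic (m : nat) (gT : finGroupType) (G : {group gT}) : Prop :=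
  (G \isog Grp (a : b : a ^+ (2 * m) = 1, b ^+ 2 = a ^+ m,
                        b * a * b^-1 = a^-1))%g.

Record sgraph := SGraph {
  vertex :> finType;
  adj : rel vertex;
  adj_sym : symmetric adj;
  adj_irr : irreflexive adj }.

Section SubgroupGeneratingBipartiteGraph.
Variables (gT : finGroupType) (G : {group gT}).

Definition sgb_vertex : finType :=
  (([subg G] * [subg G]) + {H : {group gT} | H \in subgroups G})%type.

Definition sgb_adj : rel sgb_vertex := fun u v =>
  match u, v with
  | inl (x, y), inr H | inr H, inl (x, y) =>
      val H == <<[set sgval x; sgval y]>>%G
  | _, _ => false
  end.

Lemma sgb_adj_sym : symmetric sgb_adj.
Proof. by move=> [[x y]|H] [[x' y']|H']. Qed.

Lemma sgb_adj_irr : irreflexive sgb_adj.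
Proof. by move=> [[x y]|H]. Qed.

Definition sgb_graph : sgraph := SGraph sgb_adj_sym sgb_adj_irr.

End SubgroupGeneratingBipartiteGraph.

Local Open Scope ring_scope.

Section GraphEnergies.
Variables (C : numClosedFieldType) (Gamma : sgraph).

Definition edges : {set {set Gamma}} :=
  [set [set x; y] | x : Gamma, y : Gamma in adj x].

Definition degree (x : Gamma) : nat := #|[set y | adj x y]|.

Definition common_neighbors (x y : Gamma) : {set Gamma} :=
  [set z | [&& z != x, z != y, adj z x & adj z y]].

Definition adjacency_mx : 'M[C]_#|Gamma| :=
  \matrix_(i, j) (adj (enum_val i) (enum_val j))%:R.

Definition degree_mx : 'M[C]_#|Gamma| :=
  diag_mx (\row_i (degree (enum_val i))%:R).

Definition cn_mx : 'M[C]_#|Gamma| :=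
  \matrix_(i, j) if i == j then 0
                 else #|common_neighbors (enum_val i) (enum_val j)|%:R.

(* The roots of the (monic) characteristic polynomial, repeated according to
   their multiplicities; this determines the sequence up to permutation. *)
Definition eigenvalues (n : nat) (A : 'M[C]_n) : seq C :=
  sval (closed_field_poly_normal (char_poly A)).

Definition average_degree : C := (2 * #|edges|)%:R / #|Gamma|%:R.

Definition energy : C := \sum_(z <- eigenvalues adjacency_mx) `|z|.

Definition laplacian_energy : C :=
  \sum_(z <- eigenvalues (degree_mx - adjacency_mx)) `|z - average_degree|.

Definition signless_laplacian_energy : C :=
  \sum_(z <- eigenvalues (degree_mx + adjacency_mx)) `|z - average_degree|.

Definition cn_energy : C := \sum_(z <- eigenvalues cn_mx) `|z|.

End GraphEnergies.

(* Main.v *)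
Require Import Defs.
From HB Require Import structures.
From mathcomp Require Import all_boot all_order all_fingroup all_algebra.
From mathcomp Require Import all_solvable zify ring.

(** The graph B(G) is a disjoint union of stars: each pair (x, y) is adjacent to
exactly one subgroup, the one that it generates. Writing d_H for the number of
pairs generating H, the star at H has d_H leaves, so the spectra of the four
matrices are explicit in the numbers d_H ([adj_char_poly], [lap_char_poly],
[cn_char_poly]). The three characteristic polynomials come from a single
determinant, [det_bipartite_block]. It uses the incidence matrix B between pairs
and subgroups, for which B^T B is the diagonal matrix of the d_H. Summing over
the eigenvalues, the energy is the sum of the 2 sqrt d_H. When every subgroup
is generated by two elements, the other energies depend only on N = #|G|^2 and
on the number k of subgroups: the two Laplacian energies are
2 (N^2 + k^2) / (N + k), and the common neighborhood energy is 2 (N - k).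

It remains to list the subgroups of G = Q_4p with their d_H. An element outside
<a> has order 4, so a subgroup not contained in <a> has order divisible by 4 and
dividing 4p: it is G or has order 4, and counting the 2p elements outside <a>
gives p subgroups of the latter kind ([sum_subgroups_dicyclic]). The subgroups
of the cyclic group <a> correspond to the divisors of 2p. The numbers d_H follow
from the identity that the d_K, for K <= H, add up to #|H|^2
([sum_gen_pairs]): they are 1, 3, p^2 - 1 and 3 p^2 - 3 for the cyclic groups of
orders 1, 2, p and 2p (p odd), 12 for those of order 4, and 12 p^2 - 12 p for G
itself. The case p = 2 differs only in that <a> has three subgroups instead of
four. *)

Set Implicit Arguments.
Unset Strict Implicit.
Unset Printing Implicit Defensive.

Import Order.TTheory GRing.Theory Num.Theory.

(** * The dicyclic presentation *)
Section DicyclicPresentation.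
Local Open Scope group_scope.

(** Translates the conjugation relation in the usual dihedral and quaternion
presentations, y^-1 x y = x^-1, into the one of the dicyclic presentation. *)
Lemma conj_inv_swap (gT : finGroupType) (x y : gT) :
  x ^ y = x^-1 -> y * x * y^-1 = x^-1.
Proof.
move=> xy; rewrite -xy -[x in LHS]invgK -{1}xy -conjVg conjgE !mulgA.
by rewrite mulgV mul1g mulgK xy.
Qed.

(** A presentation only bounds the order from above; the bound from below comes
from groups in which the relations hold, since their orders divide #|G|. For
odd p the cyclic group of order 4 (a |-> 2, b |-> 1) and the dihedral group
of order 2p are such quotients, and 4 and p are coprime. For p = 2 the
quaternion group of order 8 itself is used. *)
Lemma dicyclic_dvd_card (p : nat) (gT : finGroupType) (G : {group gT}) :
  prime p -> is_dicyclic p G -> 4 * p %| #|G|.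
Proof.
move=> p_pr G_Q.
have [p2 | p_odd] := even_prime p_pr.
  rewrite p2 in G_Q *.
  suff: [set: 'Q_8] \homg G by move/card_homg; rewrite (@card_quaternion 3 isT).
  rewrite G_Q.
  have /existsP[[x y]] /= := isoGrp_hom (@Grp_quaternion 3 isT).
  rewrite !xpair_eqE /= => /and4P[gen /eqP x4 /eqP yx /eqP xy].
  apply/existsP; exists (x, y).
  rewrite /= !xpair_eqE /= gen -x4 eqxx yx eqxx /=.
  by rewrite conj_inv_swap.
have p_gt1 := prime_gt1 p_pr.
rewrite Gauss_dvd; last first.
  by rewrite (@coprimeXl 2 2) // coprime2n.
apply/andP; split.
  suff: [set: 'Z_4] \homg G by move/card_homg; rewrite cardsT card_ord.
  have z2: (inZp 2 : 'Z_4) ^+ 2 = 1 by apply/eqP.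
  rewrite G_Q; apply/existsP; exists (inZp 2, inZp 1).
  rewrite /= !xpair_eqE /= eqEsubset subsetT /=.
  apply/and4P; split.
  - by rewrite (@Zp_cycle 3) joing_subr.
  - by rewrite expgM z2 expg1n.
  - rewrite -(odd_double_half p) p_odd expgD -mul2n expgM.
    by rewrite z2 expg1n.
  - by [].
suff: 'D_p.*2 \homg G.
  move/card_homg; rewrite card_dihedral // -mul2n.
  by apply: dvdn_trans; rewrite dvdn_mull.
rewrite G_Q.
have /existsP[[x y]] /= := isoGrp_hom (@Grp_dihedral p p_gt1).
rewrite !xpair_eqE /= => /and4P[gen /eqP xp /eqP y2 /eqP xy].
apply/existsP; exists (x, y); rewrite /= !xpair_eqE /= gen mulnC expgM xp y2.
by rewrite expg1n conj_inv_swap ?eqxx.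
Qed.

(** The relations give G = <a> U <a>b, hence #|G| <= 2 #[a] <= 4p, and the lower
bound on #|G| turns these into equalities. An element x = a^i b outside <a>
satisfies x^2 = a^i (b a^i b^-1) b^2 = a^p, an involution, so x has order 4. *)
Lemma dicyclic_structure (p : nat) (gT : finGroupType) (G : {group gT}) :
  prime p -> is_dicyclic p G ->
  exists a b : gT, [/\ <[a]> <*> <[b]> = G, #[a] = (2 * p)%N, #|G| = (4 * p)%N
    & {in G :\: <[a]>, forall x, #[x] = 4}].
Proof.
move=> p_pr G_Q; have dvG := dicyclic_dvd_card p_pr G_Q.
have /existsP[[a b]] /= := isoGrp_hom G_Q.
rewrite !xpair_eqE /= => /and4P[/eqP gen /eqP a2p /eqP b2 /eqP ab].
have ab' i : b * a ^+ i * b^-1 = a ^- i.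
  have cE x: b * x * b^-1 = x ^ b^-1 by rewrite conjgE invgK mulgA.
  by rewrite cE conjXg -cE ab expgVn.
have nab : b \in 'N(<[a]>).
  rewrite -groupV; apply/normP; rewrite -cycleJ conjgE invgK mulgA ab.
  by rewrite cycleV.
have elt x : x \in G -> x \notin <[a]> -> exists i, x = a ^+ i * b.
  rewrite -gen norm_joinEr ?cycle_subG //.
  case/mulsgP=> _ _ /cycleP[i ->] /cycleP[j ->] ->.
  rewrite -(odd_double_half j) expgD -[j./2.*2]mul2n expgM b2 -expgM.
  (* Here a^k is a power of b^2 = a^p, so it commutes with b. *)
  set k := (p * _)%N; have cb: b * a ^+ k = a ^+ k * b.
    by rewrite /k expgM -b2; apply/commuteX/commuteX.
  case: (odd j); last by rewrite mul1g -expgD mem_cycle.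
  by rewrite expg1 cb mulgA -expgD => _; exists (i + k)%N.
have leG : #|G| <= 2 * #[a].
  have: G \subset <[a]> :|: <[a]> :* b.
    apply/subsetP=> x Gx; rewrite inE; case: (boolP (x \in <[a]>)) => //= nAx.
    by have [i ->] := elt x Gx nAx; rewrite mem_rcoset mulgK mem_cycle.
  move/subset_leq_card/leq_trans; apply.
  by rewrite mul2n -addnn (leq_trans (leq_card_setU _ _)) // card_rcoset.
have oa2p : #[a] %| 2 * p by rewrite order_dvdn a2p.
have p_gt0 := prime_gt0 p_pr.
have oa : #[a] = (2 * p)%N.
  apply/eqP; rewrite eqn_leq dvdn_leq ?muln_gt0 //=.
  rewrite -(leq_pmul2l (isT : 0 < 2)) mulnA (leq_trans _ leG) //.
  by apply: dvdn_leq.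
exists a, b; split=> //.
  apply/eqP; rewrite eqn_leq (leq_trans leG) ?oa ?mulnA //=.
  by apply: dvdn_leq.
move=> x /setDP[Gx nAx]; have [i ->] := elt x Gx nAx.
have x2 : (a ^+ i * b) ^+ 2 = a ^+ p.
  have bai : b * a ^+ i = a ^- i * b by rewrite -ab' mulgKV.
  by rewrite -b2 !expgS !expg0 !mulg1 mulgA -(mulgA (a ^+ i)) bai mulKVg.
have nt : a ^+ p != 1.
  by rewrite -order_dvdn oa gtnNdvd // ltn_Pmull.
have x4 : (a ^+ i * b) ^+ 4 = 1 by rewrite (expgM _ 2 2) x2 -expgM mulnC a2p.
move: x2 nt x4; set y := _ * b => x2 nt x4.
have: #[y] %| 4 by rewrite order_dvdn x4.
have: ~~ (#[y] %| 2) by rewrite order_dvdn x2.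
rewrite (@dvdn_divisors _ 4) // !inE /=.
by move=> nd2 /or3P[] /eqP oy; rewrite oy in nd2 *.
Qed.
End DicyclicPresentation.

(** * Pairs generating a given subgroup *)

Section GeneratingPairs.
Local Open Scope group_scope.
Variable gT : finGroupType.
Implicit Types (G H K : {group gT}) (x y : gT).

Definition gen_pairs H : {set gT * gT} :=
  [set u | <<[set u.1; u.2]>>%G == H].

Lemma gen_pairs_gt0 x y : 0 < #|gen_pairs <<[set x; y]>>%G|.
Proof. by apply/card_gt0P; exists (x, y); rewrite inE. Qed.

Lemma gen_pairs_cyclic_gt0 H : cyclic H -> 0 < #|gen_pairs H|.
Proof.
case/cyclicP=> x Hx; suff ->: H = <<[set x; x]>>%G by apply: gen_pairs_gt0.
by apply/val_inj; rewrite /= setUid.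
Qed.

(** Each pair in H x H generates exactly one subgroup of H. *)
Lemma sum_gen_pairs H : (\sum_(K in subgroups H) #|gen_pairs K| = #|H| ^ 2)%N.
Proof.
rewrite -mulnn -cardsX -sum1_card.
rewrite (partition_big (fun u => <<[set u.1; u.2]>>%G) (mem (subgroups H))) /=.
  apply: eq_bigr => K; rewrite inE => sKH; rewrite -sum1_card.
  apply: eq_bigl => u; rewrite !inE; case: eqP => [def_K|]; rewrite ?andbF //.
  by rewrite andbT; move: sKH; rewrite -def_K gen_subG subUset !sub1set => ->.
by move=> u; rewrite !inE gen_subG subUset !sub1set.
Qed.

(** The subgroup of order d of <[x]>, meaningful only when d divides #[x]. *)
Definition cycle_sub x (d : nat) : {group gT} := <[x ^+ (#[x] %/ d)]>%G.

Lemma card_cycle_sub x d : d %| #[x] -> #|cycle_sub x d| = d.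
Proof.
move/cycle_sub_group/setP/(_ (cycle_sub x d)).
by rewrite !inE eqxx => /andP[_ /eqP].
Qed.

Lemma cycle_sub_order x : cycle_sub x #[x] = <[x]>%G.
Proof. by rewrite /cycle_sub divnn order_gt0 expg1. Qed.

(** A cyclic group has exactly one subgroup of each order dividing its own, so
its subgroups can be listed by any duplicate-free enumeration of the
divisors. *)
Lemma big_subgroups_cycle (R : Type) (idx : R) (op : Monoid.com_law idx)
    (F : {group gT} -> R) x (s : seq nat) :
    uniq s -> (forall d, (d %| #[x]) = (d \in s)) ->
  \big[op/idx]_(K in subgroups <[x]>) F K
    = \big[op/idx]_(d <- s) F (cycle_sub x d).
Proof.
move=> uniq_s mem_s.
rewrite -big_filter -(big_map (cycle_sub x) xpredT F).
apply/perm_big/uniq_perm.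
- by rewrite filter_uniq // index_enum_uniq.
- rewrite map_inj_in_uniq // => d e; rewrite -!mem_s => d_x e_x eq_de.
  by rewrite -(card_cycle_sub d_x) eq_de card_cycle_sub.
move=> K; rewrite mem_filter mem_index_enum andbT inE.
apply/idP/mapP=> [sKx | [d _ ->]]; last exact: cycleX.
exists #|K|; first by rewrite -mem_s cardSg.
by apply/set1P; rewrite -cycle_sub_group ?cardSg // inE sKx eqxx.
Qed.

Lemma dvdn_prime p d : prime p -> (d %| p) = (d \in [:: 1; p]%N).
Proof.
case/primeP=> _ p_pr; rewrite !inE; apply/idP/idP=> [/p_pr // |].
by case/pred2P=> ->; rewrite ?dvd1n.
Qed.

Lemma dvdn_double_prime p d : prime p ->
  (d %| 2 * p) = (d \in [:: 1; 2; p; 2 * p]%N).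
Proof.
move=> p_pr; apply/idP/idP=> [dv|]; last first.
  rewrite !inE => /or4P[] /eqP->; rewrite ?dvd1n //; first exact: dvdn_mulr.
  exact: dvdn_mull.
have [/dvdnP[e def_d] | nd2] := boolP (2 %| d).
  rewrite def_d mulnC dvdn_pmul2l // dvdn_prime // in dv *.
  by move: dv; rewrite !inE => /pred2P[]->; rewrite eqxx ?orbT.
rewrite Gauss_dvdr ?dvdn_prime // in dv.
  by move: dv; rewrite !inE => /pred2P[]->; rewrite eqxx ?orbT.
by rewrite coprime_sym prime_coprime.
Qed.

Lemma card_gen_pairs1 H : #|H| = 1%N -> #|gen_pairs H| = 1%N.
Proof.
move=> /eqP; rewrite -trivg_card1 => /eqP H1.
have := sum_gen_pairs H; rewrite (big_pred1 H) => [-> |K].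
  by rewrite H1 cards1.
by rewrite inE H1 subG1 -H1.
Qed.

(** For cyclic H, gen_pairs H has the size of Jordan's totient J_2 of #|H|. The
values needed are obtained by solving [sum_gen_pairs] for its top term. *)
Lemma card_gen_pairs_prime H : prime #|H| -> #|gen_pairs H| = (#|H| ^ 2 - 1)%N.
Proof.
move=> prH; have /cyclicP[x defH] := prime_cyclic prH.
have {}defH: H = <[x]>%G by apply/val_inj.
have prx : prime #[x] by rewrite orderE -[<[x]>]/(val <[x]>%G) -defH.
have := sum_gen_pairs H.
rewrite defH (@big_subgroups_cycle _ _ _ _ _ [:: 1%N; #[x]]).
- rewrite !big_cons big_nil /= cycle_sub_order.
  by rewrite card_gen_pairs1 ?card_cycle_sub ?dvd1n //; lia.
- by rewrite /= inE andbT neq_ltn prime_gt1.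
by move=> d; rewrite dvdn_prime.
Qed.

Lemma card_gen_pairs4 H : cyclic H -> #|H| = 4 -> #|gen_pairs H| = 12.
Proof.
case/cyclicP=> x defH; have {defH} ->: H = <[x]>%G by apply/val_inj.
move=> ox; have := sum_gen_pairs <[x]>%G.
have d2 : 2 %| #[x] by rewrite orderE ox.
rewrite (@big_subgroups_cycle _ _ _ _ _ [:: 1; 2; #[x]]%N).
- rewrite !big_cons big_nil /= cycle_sub_order ox.
  rewrite card_gen_pairs1 ?card_cycle_sub ?dvd1n //.
  by rewrite card_gen_pairs_prime ?card_cycle_sub //; lia.
- by rewrite orderE ox.
by move=> d; rewrite orderE ox dvdn_divisors.
Qed.

Lemma card_gen_pairs_double_prime H p : prime p -> odd p -> cyclic H ->
  #|H| = (2 * p)%N -> #|gen_pairs H| = (3 * p ^ 2 - 3)%N.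
Proof.
move=> p_pr p_odd /cyclicP[x defH].
have {defH} ->: H = <[x]>%G by apply/val_inj.
rewrite -orderE => ox; have := sum_gen_pairs <[x]>%G.
rewrite (@big_subgroups_cycle _ _ _ _ _ [:: 1; 2; p; #[x]]%N).
- have d2 : 2 %| #[x] by rewrite ox dvdn_mulr.
  have dp : p %| #[x] by rewrite ox dvdn_mull.
  rewrite !big_cons big_nil /= cycle_sub_order -orderE ox.
  rewrite card_gen_pairs1 ?card_cycle_sub ?dvd1n //.
  rewrite (@card_gen_pairs_prime (cycle_sub x 2)) ?card_cycle_sub //.
  rewrite (@card_gen_pairs_prime (cycle_sub x p)) ?card_cycle_sub //.
  by have := prime_gt1 p_pr; nia.
- by rewrite ox /= !inE; have := prime_gt1 p_pr; lia.
by move=> d; rewrite ox dvdn_double_prime.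
Qed.

End GeneratingPairs.

(** * Subgroups of a dicyclic group *)

Section DicyclicSubgroups.
Local Open Scope group_scope.
Variables (gT : finGroupType) (G : {group gT}) (p : nat) (a : gT).
Hypotheses (p_pr : prime p) (Ga : a \in G) (oG : #|G| = (4 * p)%N).
Hypotheses (oa : #[a] = (2 * p)%N) (o4 : {in G :\: <[a]>, forall x, #[x] = 4}).
Implicit Types H K : {group gT}.

(** Such an H contains an element of order 4, so 4 divides #|H|, which divides
4p with p prime. *)
Lemma dicyclic_subgroup_order H : H \subset G -> ~~ (H \subset <[a]>) ->
  H = G \/ #|H| = 4.
Proof.
move=> sHG /subsetPn[x Hx nAx].
have Gx : x \in G :\: <[a]> by rewrite inE nAx (subsetP sHG).
have : 4 %| #|H| by rewrite -(o4 Gx) order_dvdG.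
have := cardSg sHG; rewrite oG => /[swap] /dvdnP[k oH].
rewrite {1}oH mulnC dvdn_pmul2l // => /(prime_nt_dvdP _) dvk.
case: (eqVneq k 1%N) => [k1 | nk1]; [right | left]; first by rewrite oH k1.
apply/val_inj/eqP; rewrite eqEcard sHG oG oH mulnC.
by rewrite (dvk p_pr nk1) leqnn.
Qed.

(** For p = 2 the subgroup <[a]> also has order 4, whence the second
condition. *)
Definition outer_subgroups : {set {group gT}} :=
  [set H in subgroups G | (#|H| == 4) && ~~ (H \subset <[a]>)].

Lemma outer_subgroupsP H :
  reflect [/\ H \subset G, #|H| = 4 & ~~ (H \subset <[a]>)]
          (H \in outer_subgroups).
Proof. by rewrite !inE; apply: (iffP and3P) => -[? /eqP]. Qed.

Lemma outer_subgroup_eq H x : H \in outer_subgroups -> x \in H ->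
  x \notin <[a]> -> <[x]>%G = H.
Proof.
case/outer_subgroupsP=> sHG oH _ Hx nAx.
apply/val_inj/eqP; rewrite eqEcard cycle_subG Hx oH.
by rewrite -[#|_|]/#[x] o4 // inE nAx (subsetP sHG).
Qed.

(** H is generated by an element x of order 4 outside <[a]>, and H meets <[a]>
in the subgroup of order 2 generated by x^2. *)
Lemma card_outer_subgroup H : H \in outer_subgroups -> #|H :\: <[a]>| = 2.
Proof.
move=> oH; have [sHG cH nsHA] := outer_subgroupsP _ oH.
have /subsetPn[x Hx nAx] := nsHA.
have def_H := outer_subgroup_eq oH Hx nAx.
have ox : #[x] = 4 by rewrite o4 // inE nAx (subsetP sHG).
have Ax2 : x ^+ 2 \in <[a]>.
  apply: contraT => nAx2; have := o4 (x := x ^+ 2).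
  rewrite inE nAx2 groupX ?(subsetP sHG) //.
  by rewrite orderXdiv ox // => /(_ isT).
have dv : #|H :&: <[a]>| %| 4 by rewrite -cH cardSg ?subsetIl.
have gt1: 2 %| #|H :&: <[a]>|.
  have <- : #[x ^+ 2] = 2 by rewrite orderXdiv ox.
  by rewrite order_dvdG // inE groupX.
have lt4 : #|H :&: <[a]>| < 4.
  rewrite -cH; apply: proper_card; rewrite properE subsetIl /=.
  by apply: contra nsHA => /subset_trans-> //; rewrite subsetIr.
have := cardsID <[a]> H; rewrite cH.
have := cardG_gt0 (H :&: <[a]>); lia.
Qed.

(** The 2p elements outside <[a]> are partitioned by the outer subgroups, in
classes of size 2. *)
Lemma card_outer_subgroups : #|outer_subgroups| = p.
Proof.
apply/eqP; rewrite -(eqn_pmul2r (isT : 0 < 2)) -sum_nat_const.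
have <-: #|G :\: <[a]>| = (p * 2)%N.
  have := cardsID <[a]> G.
  by rewrite (setIidPr _) ?cycle_subG // -[#|<[a]>|]/#[a] oa oG; lia.
rewrite -sum1_card eq_sym.
rewrite (partition_big (fun x => <[x]>%G) (mem outer_subgroups)) /=.
  apply/eqP/eq_bigr => H oH; rewrite -(card_outer_subgroup oH) -sum1_card.
  apply: eq_bigl => x; rewrite !inE; have [sHG _ _] := outer_subgroupsP _ oH.
  apply/idP/idP=> [/andP[/andP[-> _] /eqP <-]|/andP[nAx Hx]].
    exact: cycle_id.
  by rewrite nAx (subsetP sHG) //=; apply/eqP/outer_subgroup_eq.
move=> x /setDP[Gx nAx]; rewrite !inE cycle_subG Gx cycle_subG nAx.
by rewrite -[#|_|]/#[x] o4 // inE nAx.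
Qed.

Lemma sum_subgroups_dicyclic (V : nmodType) (F : {group gT} -> V) c :
    (forall H, cyclic H -> #|H| = 4 -> F H = c) ->
  (\sum_(H in subgroups G) F H
    = \sum_(H in subgroups <[a]>) F H + c *+ p + F G)%R.
Proof.
move=> Fc; have p_gt1 := prime_gt1 p_pr.
have nGA : ~~ (G \subset <[a]>).
  by apply/negP=> /subset_leq_card; rewrite oG -[#|_|]/#[a] oa; lia.
have nG4 : #|G| != 4 by rewrite oG; lia.
rewrite (bigID (fun H : {group gT} => H \subset <[a]>)) /= -addrA.
congr (_ + _)%R.
  apply: eq_bigl => H; rewrite !inE; apply: andb_idl => sHA.
  by rewrite (subset_trans sHA) // cycle_subG.
rewrite (bigD1 G) /= ?inE ?subxx ?nGA // addrC; congr (_ + _)%R.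
rewrite (eq_bigl (mem outer_subgroups)) => [|H]; last first.
  rewrite !inE -andbA; apply: andb_id2l => sHG; rewrite andbC.
  apply: andb_id2r => nHA; apply/idP/idP=> [nHG|/eqP oH].
    by have [/eqP|->] := dicyclic_subgroup_order sHG nHA; rewrite ?(negPf nHG).
  by apply: contra nG4 => /eqP <-; rewrite oH.
rewrite (eq_bigr (fun _ => c)) => [|H oH]; last first.
  have [sHG cH /subsetPn[x Hx nAx]] := outer_subgroupsP _ oH.
  by rewrite Fc // -(outer_subgroup_eq oH Hx nAx) cycle_cyclic.
by rewrite sumr_const card_outer_subgroups.
Qed.

Lemma card_gen_pairs_dicyclic : #|gen_pairs G| = (12 * p ^ 2 - 12 * p)%N.
Proof.
have := sum_gen_pairs G; have := sum_gen_pairs <[a]>%G.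
rewrite (sum_subgroups_dicyclic (@card_gen_pairs4 gT)) => ->.
rewrite oG -[#|_|]/#[a] oa -mulr_natr natn -[LHS]/(_ + 12 * p + _)%N; nia.
Qed.

End DicyclicSubgroups.

(** * Determinants and sums over eigenvalues *)

Local Open Scope ring_scope.

(** The determinant of a matrix indexed by a finite type does not depend on how
that type is enumerated: another enumeration permutes rows and columns
alike. *)
Lemma det_reindex (R : comNzRingType) (T : finType) k (g : 'I_k -> T)
    (f : T -> T -> R) : bijective g ->
  \det (\matrix_(i < #|T|, j < #|T|) f (enum_val i) (enum_val j))
    = \det (\matrix_(i < k, j < k) f (g i) (g j)).
Proof.
move=> bij_g; have kE : k = #|T| by rewrite -(bij_eq_card bij_g) card_ord.
subst k; have inj_s : injective (enum_rank \o g).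
  by move=> i j /enum_rank_inj /(bij_inj bij_g).
set M := \matrix_(i, j) _; pose s := perm inj_s.
have -> : \matrix_(i, j) f (g i) (g j) = row_perm s (col_perm s M).
  by apply/matrixP=> i j; rewrite !mxE !permE /= !enum_rankK.
rewrite row_permE col_permE !det_mulmx !det_perm odd_permV mulrCA.
by rewrite -signr_addb addbb mulr1.
Qed.

(** Lets the vertices of a bipartite graph be enumerated one side after the
other, so that its matrices take block form. *)
Lemma det_sum_index (R : comNzRingType) (X Y : finType)
    (f : X + Y -> X + Y -> R) :
  \det (\matrix_(i < #|{: X + Y}|, j < #|{: X + Y}|)
          f (enum_val i) (enum_val j))
    = \det (block_mx
        (\matrix_(i < #|X|, j < #|X|) f (inl (enum_val i)) (inl (enum_val j)))
        (\matrix_(i < #|X|, j < #|Y|) f (inl (enum_val i)) (inr (enum_val j)))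
        (\matrix_(i < #|Y|, j < #|X|) f (inr (enum_val i)) (inl (enum_val j)))
        (\matrix_(i < #|Y|, j < #|Y|) f (inr (enum_val i)) (inr (enum_val j)))).
Proof.
pose g (i : 'I_(#|X| + #|Y|)) : X + Y :=
  match split i with inl j => inl (enum_val j) | inr j => inr (enum_val j) end.
rewrite (@det_reindex _ _ _ g).
  congr (\det _); apply/matrixP=> i j; rewrite mxE /g.
  by case: (split_ordP i) => i' ->; case: (split_ordP j) => j' ->;
    rewrite ?block_mxEul ?block_mxEur ?block_mxEdl ?block_mxEdr mxE.
apply: (@Bijective _ _ _ (fun u => match u with
  | inl x => lshift _ (enum_rank x) | inr y => rshift _ (enum_rank y) end)).
  by move=> i; rewrite /g; case: (split_ordP i) => j ->; rewrite enum_valK.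
by case=> [x|y]; rewrite /g (unsplitK (inl _), unsplitK (inr _)) enum_rankK.
Qed.

(** Schur complement without division. Multiplying on the right by the block
matrix [1, -uB; 0, t], of determinant t^n, clears the upper right block, and
leaves t diag(s) - u^2 B^T B, which is diagonal, in the lower right one. *)
Lemma det_bipartite_block (R : comNzRingType) m n (B : 'M[R]_(m, n))
    (d s : 'rV[R]_n) (t u : R) : B^T *m B = diag_mx d ->
  \det (block_mx t%:M (u *: B) (u *: B^T) (diag_mx s)) * t ^+ n
    = t ^+ m * \prod_j (t * s 0 j - u ^+ 2 * d 0 j).
Proof.
move=> BB; have -> : t ^+ n = \det (block_mx (1%:M : 'M_m) (- u *: B) 0 t%:M).
  by rewrite det_ublock det1 mul1r det_scalar.
rewrite -det_mulmx mulmx_block !mulmx0 !mulmx1 !addr0.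
have -> : t%:M *m (- u *: B) + (u *: B) *m t%:M = 0.
  by rewrite mul_scalar_mx mul_mx_scalar !scalerA mulrN mulrC scaleNr addNr.
rewrite det_lblock det_scalar; congr (_ * _).
have -> : u *: B^T *m (- u *: B) + diag_mx s *m t%:M
    = diag_mx (\row_j (t * s 0 j - u ^+ 2 * d 0 j)).
  rewrite -scalemxAl -scalemxAr BB scalerA mul_mx_scalar mulrN -expr2.
  apply/matrixP=> i j; rewrite !mxE.
  by case: eqP => _; rewrite /= ?mulr1n ?mulr0n; ring.
by rewrite det_diag; apply: eq_bigr => j _; rewrite mxE.
Qed.

(** Expresses the determinant of t - B B^T by that of a bipartite block matrix,
to which [det_bipartite_block] applies with the other Gram matrix, B^T B. *)
Lemma det_sub_gram (R : comNzRingType) m n (B : 'M[R]_(m, n)) (t : R) :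
  \det (t%:M - B *m B^T) = \det (block_mx t%:M B B^T 1%:M).
Proof.
rewrite -[RHS]mulr1.
rewrite -[X in _ * X]
  (_ : \det (block_mx (1%:M : 'M_m) 0 (- B^T) (1%:M : 'M_n)) = 1).
  rewrite -det_mulmx mulmx_block !mulmx0 !mulmx1 !add0r mulmxN mul1mx subrr.
  by rewrite det_ublock det1 mulr1.
by rewrite det_lblock !det1 mulr1.
Qed.

Section EigenvalueSums.
Variable C : numClosedFieldType.

Lemma char_poly_eigenvalues n (A : 'M[C]_n) :
  char_poly A = \prod_(z <- eigenvalues A) ('X - z%:P).
Proof.
rewrite /eigenvalues; case: closed_field_poly_normal => s /= defA.
by rewrite {1}defA (monicP (char_poly_monic A)) scale1r.
Qed.

(** The factors ('X - c) ^+ k avoid any comparison of k with l: the roots of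
both sides agree as multisets, so any function has the same sum over both. *)
Lemma sum_eigenvalues (Y : finType) n (A : 'M[C]_n) (F : C -> C) c
    (a b : Y -> C) k l :
  char_poly A * ('X - c%:P) ^+ k
    = ('X - c%:P) ^+ l * \prod_y (('X - (a y)%:P) * ('X - (b y)%:P)) ->
  \sum_(z <- eigenvalues A) F z + F c *+ k
    = F c *+ l + \sum_y (F (a y) + F (b y)).
Proof.
rewrite char_poly_eigenvalues big_split /= => eqp.
have nseqE j : \prod_(z <- nseq j c) ('X - z%:P) = ('X - c%:P) ^+ j.
  by rewrite big_nseq; elim: j => //= j ->; rewrite exprS.
have eq_s : perm_eq (eigenvalues A ++ nseq k c)
    (nseq l c ++ (map a (index_enum Y) ++ map b (index_enum Y))).
  by apply: prod_XsubC_eq; rewrite !big_cat /= !nseqE !big_map.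
have := perm_big (op := +%R) (x := 0) _ eq_s (P := xpredT) (F := F).
rewrite !big_cat /= !big_map big_split /=.
suff sE j : \sum_(z <- nseq j c) F z = F c *+ j by rewrite !sE.
by rewrite big_nseq; elim: j => //= j ->; rewrite mulrS.
Qed.
End EigenvalueSums.

(** * Energies of star forests *)

(** A map f : X -> Y defines a bipartite graph on X + Y with edges joining x to
f x; it is the disjoint union over y of stars whose leaves are the fibres of
f. [eE] describes adjacency pointwise so that any adjacency relation of this
shape qualifies. *)
Section StarForest.
Variables (C : numClosedFieldType) (X Y : finType) (f : X -> Y).
Variables (e : rel (X + Y)%type) (e_sym : symmetric e) (e_irr : irreflexive e).
Hypothesis eE : forall u v, e u v =
  match u, v with
  | inl x, inr y | inr y, inl x => f x == y
  | _, _ => false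
  end.

Let Gamma : sgraph := SGraph e_sym e_irr.

Definition leaves (y : Y) : {set X} := [set x | f x == y].

Lemma sum_leaves : (\sum_y #|leaves y| = #|X|)%N.
Proof.
rewrite -sum1_card (partition_big f xpredT) //; apply: eq_bigr => y _.
by rewrite -sum1_card; apply: eq_bigl => x; rewrite inE.
Qed.

Definition incidence (R : comNzRingType) : 'M[R]_(#|X|, #|Y|) :=
  \matrix_(i, j) (f (enum_val i) == enum_val j)%:R.

(** The fibres of f are disjoint, so distinct columns are orthogonal. *)
Lemma incidence_gram (R : comNzRingType) :
  (incidence R)^T *m incidence R = diag_mx (\row_j #|leaves (enum_val j)|%:R).
Proof.
apply/matrixP=> i j; rewrite !mxE.
rewrite (eq_bigr (fun k =>
  if (f (enum_val k) == enum_val i) then (i == j)%:R else 0)); last first.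
  move=> k _; rewrite !mxE; case: eqP => [->|_]; last by rewrite mul0r.
  by rewrite mul1r (inj_eq enum_val_inj).
rewrite -big_mkcond /= sumr_const.
case: eqP => _; last by rewrite mulr0n mul0rn.
rewrite mulr1n; congr _%:R; rewrite /leaves -(card_image enum_val_inj).
apply: eq_card => x; rewrite inE; apply/imageP/idP => [[k + ->] //|fx].
by exists (enum_rank x); rewrite ?enum_rankK // unfold_in enum_rankK.
Qed.

Lemma incidence_cogram (R : comNzRingType) i j :
  (incidence R *m (incidence R)^T) i j = (f (enum_val i) == f (enum_val j))%:R.
Proof.
rewrite mxE (bigD1 (enum_rank (f (enum_val i)))) //= big1 => [|k].
  by rewrite !mxE enum_rankK eqxx mul1r addr0 eq_sym.
rewrite !mxE -(inj_eq enum_val_inj) enum_rankK eq_sym => /negPf->.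
by rewrite mul0r.
Qed.

Lemma prod_over_centers (R : comNzRingType) (h : Y -> R) :
  \prod_(j < #|Y|) h (enum_val j) = \prod_y h y.
Proof. by rewrite [RHS](reindex _ (onW_bij _ (enum_val_bij Y))). Qed.

(** A star with d leaves has the eigenvalues sqrt d and - sqrt d, and d - 1 times
the eigenvalue 0. *)
Lemma adj_char_poly :
  char_poly (adjacency_mx C Gamma) * ('X - 0%:P) ^+ #|Y|
  = ('X - 0%:P) ^+ #|X| * \prod_y (('X - (sqrtC #|leaves y|%:R)%:P) *
                                  ('X - (- sqrtC #|leaves y|%:R)%:P)).
Proof.
rewrite /char_poly.
rewrite [X in \det X](_ : _ = \matrix_(i, j) ('X *+ (enum_val i == enum_val j) -
   ((e (enum_val i) (enum_val j))%:R)%:P)); last first.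
  by apply/matrixP=> i j; rewrite !mxE (inj_eq enum_val_inj).
rewrite (@det_sum_index _ _ _ (fun u v => 'X *+ (u == v) - (e u v)%:R%:P)).
rewrite [X in \det X](_ : _ = block_mx 'X%:M
   ((-1) *: incidence _) ((-1) *: (incidence _)^T)
   (diag_mx (\row__ 'X))); last first.
  congr block_mx; apply/matrixP=> i j; rewrite !mxE eE.
  - by rewrite (inj_eq inl_inj) (inj_eq enum_val_inj) subr0.
  - by rewrite mulr0n add0r polyC_natr mulN1r.
  - by rewrite mulr0n add0r polyC_natr mulN1r.
  by rewrite (inj_eq inr_inj) (inj_eq enum_val_inj) subr0.
rewrite subr0 (det_bipartite_block _ _ _ (incidence_gram _)); congr (_ * _).
rewrite -prod_over_centers; apply: eq_bigr => j _.
rewrite !mxE sqrrN expr1n mul1r.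
rewrite polyCN opprK -subr_sqr -expr2 -rmorphXn /= sqrtCK.
by rewrite polyC_natr.
Qed.

Lemma degree_left x : degree (Gamma := Gamma) (inl x) = 1%N.
Proof.
rewrite /degree -(cards1 (inr (f x) : X + Y)); apply: eq_card => -[x'|y].
  by rewrite !inE /= eE.
by rewrite !inE /= eE (inj_eq inr_inj) eq_sym.
Qed.

Lemma degree_right y : degree (Gamma := Gamma) (inr y) = #|leaves y|.
Proof.
rewrite /degree -(card_imset _ (@inl_inj X Y)).
apply: eq_card => u; rewrite inE /= eE.
apply/idP/imsetP=> [|[x + ->]]; last by rewrite inE.
by case: u => // x fx; exists x; rewrite ?inE.
Qed.

(** Taking c = -1 and c = 1 covers the Laplacian and the signless Laplacian,
which have the same spectrum because the graph is bipartite. A star with d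
leaves contributes 0, d + 1, and 1 with multiplicity d - 1. *)
Lemma lap_char_poly (c : C) : c ^+ 2 = 1 ->
  char_poly (degree_mx C Gamma + c *: adjacency_mx C Gamma)
    * ('X - 1%:P) ^+ #|Y|
  = ('X - 1%:P) ^+ #|X|
    * \prod_y (('X - 0%:P) * ('X - (#|leaves y|%:R + 1)%:P)).
Proof.
move=> c2; rewrite /char_poly.
pose h (u v : X + Y) : {poly C} :=
  ('X - (degree (Gamma := Gamma) u)%:R%:P) *+ (u == v) - (c * (e u v)%:R)%:P.
rewrite [X in \det X](_ : _ = \matrix_(i, j) h (enum_val i) (enum_val j));
  last first.
  apply/matrixP=> i j; rewrite !mxE /h (inj_eq enum_val_inj) polyCD opprD addrA.
  by rewrite mulrnBl polyCMn.
rewrite det_sum_index.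
rewrite [X in \det X](_ : _ = block_mx ('X - 1%:P)%:M (- c%:P *: incidence _)
   (- c%:P *: (incidence _)^T)
   (diag_mx (\row_j ('X - #|leaves (enum_val j)|%:R%:P)))); last first.
  congr block_mx; apply/matrixP=> i j;
    rewrite !mxE /h eE ?degree_left ?degree_right.
  - by rewrite (inj_eq inl_inj) (inj_eq enum_val_inj) mulr0 subr0.
  - by rewrite mulr0n add0r polyCM polyC_natr mulNr.
  - by rewrite mulr0n add0r polyCM polyC_natr mulNr.
  by rewrite (inj_eq inr_inj) (inj_eq enum_val_inj) mulr0 subr0.
rewrite (det_bipartite_block _ _ _ (incidence_gram _)); congr (_ * _).
rewrite -prod_over_centers; apply: eq_bigr => j _.
rewrite !mxE sqrrN -rmorphXn /= c2 polyCD -polyC_natr; ring.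
Qed.

Lemma card_common_neighbors_left x x' : x != x' ->
  #|common_neighbors (Gamma := Gamma) (inl x) (inl x')| = (f x == f x').
Proof.
move=> neq_x; case: eqP => fx.
  rewrite -[RHS](cards1 (inr (f x) : X + Y)); apply: eq_card => -[z|y].
    by rewrite !inE /= !eE !andbF.
  by rewrite !inE /= !eE (inj_eq inr_inj) -fx andbb eq_sym.
apply: eq_card0 => -[z|y]; rewrite !inE /= !eE ?andbF //.
by apply/negP=> /andP[/eqP <- /eqP/esym].
Qed.

Lemma card_common_neighbors_right u y : u != inr y ->
  #|common_neighbors (Gamma := Gamma) u (inr y)| = 0%N.
Proof.
move=> neq_u; apply: eq_card0 => z; rewrite !inE /= !eE.
case: u neq_u => [x|y']; case: z => [z|y''] //=; rewrite ?andbF //.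
rewrite (inj_eq inr_inj) => /negP nyy; apply/negP=> /andP[/eqP zy' /eqP zy].
by apply: nyy; rewrite -zy' zy.
Qed.

(** Two leaves have a common neighbour exactly when they lie on the same star,
and centers have none, so a star with d leaves contributes the spectrum of
the complete graph on d vertices, which is d - 1 and -1 with multiplicity d
- 1, together with a 0 for its center. *)
Lemma cn_char_poly :
  char_poly (cn_mx C Gamma) * ('X - (-1)%:P) ^+ #|Y|
  = ('X - (-1)%:P) ^+ #|X|
    * \prod_y (('X - 0%:P) * ('X - (#|leaves y|%:R - 1)%:P)).
Proof.
pose cn (u v : X + Y) := #|common_neighbors (Gamma := Gamma) u v|.
have cnC u v : cn u v = cn v u.
  by apply: eq_card => z; rewrite !inE andbCA [adj z u && _]andbC.
pose h (u v : X + Y) : {poly C} :=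
  'X *+ (u == v) - (if u == v then 0 else (cn u v)%:R)%:P.
rewrite /char_poly.
rewrite [X in \det X](_ : _ = \matrix_(i, j) h (enum_val i) (enum_val j));
  last first.
  by apply/matrixP=> i j; rewrite !mxE /h (inj_eq enum_val_inj).
rewrite det_sum_index.
rewrite [X in \det X](_ : _ = block_mx
   (('X + 1)%:M - incidence _ *m (incidence _)^T) 0 0 'X%:M); last first.
  congr block_mx; apply/matrixP=> i j; rewrite /h ![in LHS]mxE.
  - have -> (t : {poly C}) : (t%:M - incidence _ *m (incidence _)^T) i j
        = t *+ (i == j) - (f (enum_val i) == f (enum_val j))%:R.
      by rewrite mxE [X in _ + X]mxE incidence_cogram mxE.
    rewrite (inj_eq inl_inj) (inj_eq enum_val_inj).
    case: eqP => [->|/eqP nij]; first by rewrite eqxx polyC0; ring.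
    rewrite mulr0n /cn card_common_neighbors_left ?(inj_eq enum_val_inj) //.
    by rewrite polyC_natr mulr0n.
  - by rewrite mxE mulr0n /cn card_common_neighbors_right // polyC0 subr0.
  - by rewrite mxE mulr0n cnC /cn card_common_neighbors_right // polyC0 subr0.
  rewrite mxE (inj_eq inr_inj) (inj_eq enum_val_inj); case: eqP => [_|/eqP nij].
    by rewrite polyC0 subr0.
  rewrite /cn card_common_neighbors_right ?polyC0 ?subr0 //.
  by rewrite (inj_eq inr_inj) (inj_eq enum_val_inj).
rewrite det_ublock det_scalar det_sub_gram polyCN opprK polyC1.
rewrite [X in \det X](_ : _ = block_mx ('X + 1)%:M (1 *: incidence _)
   (1 *: (incidence _)^T) (diag_mx (\row_j 1))); last first.
  rewrite !scale1r; congr block_mx.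
  by apply/matrixP=> i j; rewrite !mxE.
rewrite mulrAC (det_bipartite_block _ _ _ (incidence_gram _)) -mulrA.
congr (_ * _).
rewrite big_split /= prodr_const subr0 mulrC; congr (_ * _).
rewrite -prod_over_centers; apply: eq_bigr => j _.
by rewrite !mxE polyCB polyC_natr expr1n mul1r polyC1 mulr1; ring.
Qed.

Lemma card_star_vertices : #|Gamma| = (#|X| + #|Y|)%N.
Proof. exact: card_sum. Qed.

(** Each x lies on exactly one edge, the one joining it to f x. *)
Lemma card_star_edges : #|edges Gamma| = #|X|.
Proof.
have inj_g : injective (fun x : X => [set inl x; inr (f x)] : {set X + Y}).
  by move=> x x' /setP/(_ (inl x)); rewrite !inE eqxx /= orbF => /esym/eqP[].
rewrite -[RHS](card_imset _ inj_g).
apply: eq_card => E.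
apply/imset2P/imsetP => [[u v _ + ->]|[x _ ->]]; last first.
  by exists (inl x) (inr (f x)); rewrite ?inE //= unfold_in /= eE.
rewrite unfold_in /= eE; case: u v => [x|y] [x'|y'] // /eqP <-.
  by exists x.
by exists x'; rewrite // setUC.
Qed.

Lemma star_energy :
  energy C Gamma = \sum_y 2 * sqrtC #|leaves y|%:R.
Proof.
have := sum_eigenvalues (fun z => `|z|) adj_char_poly.
rewrite normr0 !mul0rn addr0 add0r /energy => ->; apply: eq_bigr => y _.
by rewrite normrN ger0_norm ?sqrtC_ge0 ?ler0n //; ring.
Qed.

Hypothesis f_surj : forall y, exists x, f x = y.

Let leaves_gt0 y : (0 < #|leaves y|)%N.
Proof.
by have [x fx] := f_surj y; apply/card_gt0P; exists x; rewrite inE fx.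
Qed.

Lemma card_centers : (#|Y| <= #|X|)%N.
Proof. by rewrite -sum_leaves -sum1_card; apply: leq_sum. Qed.

Lemma star_cn_energy : cn_energy C Gamma = 2 * (#|X|%:R - #|Y|%:R).
Proof.
have := sum_eigenvalues (fun z => `|z|) cn_char_poly.
rewrite normrN normr1 -/(cn_energy C Gamma) => /(canRL (addrK _)) ->.
rewrite (eq_bigr (fun y => #|leaves y|%:R - 1)) => [|y _]; last first.
  by rewrite normr0 add0r ger0_norm // subr_ge0 ler1n.
rewrite sumrB -natr_sum sum_leaves sumr_const; ring.
Qed.

(** Write m = #|X|, n = #|Y| and al = 2m / (m + n) for the average degree. As f
is onto, n <= m, so 1 <= al <= 2 <= d + 1 for each fibre size d. This fixes
the sign of each term; the sum is (al - 1)(m - n) + m + n. *)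
Lemma star_laplacian_sum (c : C) : c ^+ 2 = 1 -> (0 < #|X|)%N ->
  \sum_(z <- eigenvalues (degree_mx C Gamma + c *: adjacency_mx C Gamma))
     `|z - average_degree C Gamma|
  = 2 * (#|X|%:R ^+ 2 + #|Y|%:R ^+ 2) / (#|X| + #|Y|)%:R.
Proof.
move=> c2 X0.
have := sum_eigenvalues (fun z => `|z - average_degree C Gamma|)
  (lap_char_poly c2).
move=> /(canRL (addrK _)) ->.
have: average_degree C Gamma = (2 * #|X|)%:R / (#|X| + #|Y|)%:R.
  by rewrite /average_degree card_star_edges card_star_vertices.
move: (average_degree _ _) => al alE.
set m := #|X| in X0 alE *; set n := #|Y| in alE *.
have mn0 : 0 < (m + n)%:R :> C by rewrite ltr0n addn_gt0 X0.
have al1 : 1 <= al.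
  rewrite alE ler_pdivlMr // mul1r ler_nat mul2n -addnn leq_add2l.
  exact: card_centers.
have al2 : al <= 2.
  by rewrite alE ler_pdivrMr // -natrM ler_nat leq_mul2l leq_addr.
rewrite (eq_bigr (fun y : Y => #|leaves y|%:R + 1)) => [|y _]; last first.
  rewrite sub0r normrN ger0_norm; last exact: le_trans al1.
  rewrite ger0_norm; first by ring.
  rewrite subr_ge0 (le_trans al2) // -[1%R]/(1%:R) -natrD ler_nat.
  by rewrite addn1 ltnS.
rewrite big_split /= -natr_sum sum_leaves sumr_const.
rewrite ler0_norm ?subr_le0 //.
rewrite -/m -/n alE; move: mn0; rewrite lt0r => /andP[mn0 _].
by rewrite !natrM natrD in mn0 *; field.
Qed.

Lemma star_laplacian_energy : (0 < #|X|)%N ->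
  laplacian_energy C Gamma
  = 2 * (#|X|%:R ^+ 2 + #|Y|%:R ^+ 2) / (#|X| + #|Y|)%:R.
Proof.
rewrite /laplacian_energy -scaleN1r; apply: star_laplacian_sum.
by rewrite sqrrN expr1n.
Qed.

Lemma star_signless_laplacian_energy : (0 < #|X|)%N ->
  signless_laplacian_energy C Gamma
  = 2 * (#|X|%:R ^+ 2 + #|Y|%:R ^+ 2) / (#|X| + #|Y|)%:R.
Proof.
rewrite /signless_laplacian_energy -[X in _ + X]scale1r.
by apply: star_laplacian_sum; rewrite expr1n.
Qed.

End StarForest.

(** * The subgroup generating bipartite graph *)

(** The graph of G is the star forest of the map sending a pair to the subgroup
that it generates. *)
Section SubgroupGeneratingGraph.
Variables (gT : finGroupType) (G : {group gT}).

Let pairs : finType := ([subg G] * [subg G])%type.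
Let subgroup : finType := {H : {group gT} | H \in subgroups G}.

Lemma generated_subgroup (u : pairs) :
  <<[set sgval u.1; sgval u.2]>>%G \in subgroups G.
Proof. by rewrite inE gen_subG subUset !sub1set !subgP. Qed.

Definition generated (u : pairs) : subgroup :=
  exist (fun H => H \in subgroups G) _ (generated_subgroup u).

Lemma sgb_adjE (u v : sgb_vertex G) : sgb_adj u v =
  match u, v with
  | inl x, inr y | inr y, inl x => generated x == y
  | _, _ => false
  end.
Proof. by case: u v => [[x y]|H] [[x' y']|H'] //=; rewrite -val_eqE eq_sym. Qed.

Lemma card_leaves_generated (H : subgroup) :
  #|leaves generated H| = #|gen_pairs (val H)|.
Proof.
pose j (u : pairs) := (sgval u.1, sgval u.2).
have inj_j : injective j.
  by move=> [x y] [x' y'] [/val_inj -> /val_inj ->].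
rewrite -(card_imset _ inj_j); apply: eq_card => -[x y].
apply/imsetP/idP=> [[u + [-> ->]]|]; first by rewrite !inE -val_eqE.
rewrite inE => /eqP /= defH; have: <<[set x; y]>>%G \in subgroups G.
  by rewrite defH; apply: valP.
rewrite inE gen_subG subUset !sub1set => /andP[Gx Gy].
exists (subg G x, subg G y); last by rewrite /j /= !subgK.
by rewrite inE -val_eqE /= !subgK //; apply/eqP.
Qed.

Lemma card_pairs : #|pairs| = (#|G| ^ 2)%N.
Proof. by rewrite card_prod -cardsT -(card_isog (isog_subg G)) mulnn. Qed.

Lemma card_subgroup : #|subgroup| = #|subgroups G|.
Proof. by rewrite card_sig. Qed.

Lemma sum_subgroup (V : nmodType) (F : {group gT} -> V) :
  \sum_(H : subgroup) F (val H) = \sum_(H in subgroups G) F H.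
Proof. by rewrite [RHS]big_sub. Qed.
Variable C : numClosedFieldType.

Lemma sgb_energy :
  energy C (sgb_graph G) = \sum_(H in subgroups G) 2 * sqrtC #|gen_pairs H|%:R.
Proof.
rewrite (star_energy _ _ _ sgb_adjE) -sum_subgroup.
by apply: eq_bigr => H _; rewrite card_leaves_generated.
Qed.

Hypothesis gen2 : forall H : {group gT}, H \subset G -> (0 < #|gen_pairs H|)%N.

Let generated_surj H : exists u, generated u = H.
Proof.
have sHG : val H \subset G by have := valP H; rewrite inE.
have := gen2 sHG; rewrite -card_leaves_generated => /card_gt0P[u].
by rewrite inE => /eqP; exists u.
Qed.

Let pairs_gt0 : (0 < #|pairs|)%N.
Proof. by rewrite card_pairs expn_gt0 cardG_gt0. Qed.

Lemma sgb_laplacian_energy :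
  laplacian_energy C (sgb_graph G)
  = 2 * (#|G|%:R ^+ 4 + #|subgroups G|%:R ^+ 2)
    / (#|G| ^ 2 + #|subgroups G|)%:R.
Proof.
rewrite (star_laplacian_energy _ _ _ sgb_adjE) //.
by rewrite card_pairs card_subgroup natrX -exprM.
Qed.

Lemma sgb_signless_laplacian_energy :
  signless_laplacian_energy C (sgb_graph G)
  = 2 * (#|G|%:R ^+ 4 + #|subgroups G|%:R ^+ 2)
    / (#|G| ^ 2 + #|subgroups G|)%:R.
Proof.
rewrite (star_signless_laplacian_energy _ _ _ sgb_adjE) //.
by rewrite card_pairs card_subgroup natrX -exprM.
Qed.

Lemma sgb_cn_energy :
  cn_energy C (sgb_graph G) = 2 * (#|G|%:R ^+ 2 - #|subgroups G|%:R).
Proof.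
rewrite (star_cn_energy _ _ _ sgb_adjE) //.
by rewrite card_pairs card_subgroup natrX.
Qed.

End SubgroupGeneratingGraph.

Section Dicyclic.
Variables (p : nat) (gT : finGroupType) (G : {group gT}).
Hypotheses (p_pr : prime p) (G_Q4p : is_dicyclic p G).

(** Since p is prime, a proper subgroup of G is cyclic: it lies in <[a]> or is
generated by an element of order 4. *)
Lemma dicyclic_gen2 (H : {group gT}) : H \subset G -> (0 < #|gen_pairs H|)%N.
Proof.
have [a [b [genG oa oG o4]]] := dicyclic_structure p_pr G_Q4p.
have Ga : (a \in G)%g by rewrite -genG (subsetP (joing_subl _ _)) ?cycle_id.
move=> sHG; have [sHA | nsHA] := boolP (H \subset <[a]>%g).
  by apply/gen_pairs_cyclic_gt0/(cyclicS sHA)/cycle_cyclic.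
have [-> | oH] := dicyclic_subgroup_order p_pr oG o4 sHG nsHA.
  suff ->: G = <<[set a; b]>>%G by apply: gen_pairs_gt0.
  by apply/val_inj; rewrite /= -genG joing_idl joing_idr.
have /subsetPn[x Hx nAx] := nsHA; apply/gen_pairs_cyclic_gt0/cyclicP; exists x.
apply/eqP; rewrite eq_sym eqEcard cycle_subG Hx oH.
by rewrite -[#|_|]/#[x]%g o4 // inE nAx (subsetP sHG).
Qed.

(** The first summand lists the subgroups of <[a]>, cyclic of order 2p: there
are four of them, of orders 1, 2, p and 2p, except that 2 and p coincide for
p = 2. The other summands stand for the p subgroups of order 4 outside <[a]>
and for G itself. *)
Lemma dicyclic_sum (V : nmodType) (F : nat -> V) :
  \sum_(H in subgroups G) F #|gen_pairs H|
  = (if p == 2%N then F 1%N + F 3%N + F 12%N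
     else F 1%N + F 3%N + F (p ^ 2 - 1)%N + F (3 * p ^ 2 - 3)%N)
    + F 12%N *+ p + F (12 * p ^ 2 - 12 * p)%N.
Proof.
have [a [b [genG oa oG o4]]] := dicyclic_structure p_pr G_Q4p.
have Ga : (a \in G)%g by rewrite -genG (subsetP (joing_subl _ _)) ?cycle_id.
rewrite (sum_subgroups_dicyclic p_pr Ga oG oa o4
  (F := fun H => F #|gen_pairs H|) (c := F 12%N)); last first.
  by move=> H cycH oH; rewrite card_gen_pairs4.
rewrite (card_gen_pairs_dicyclic p_pr Ga oG oa o4); congr (_ + _ + _).
have d2 : (2 %| #[a]%g)%N by rewrite oa dvdn_mulr.
have dp : (p %| #[a]%g)%N by rewrite oa dvdn_mull.
case: (eqVneq p 2%N) => [p2 | pn2].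
  have oa4 : #[a]%g = 4 by rewrite oa p2.
  rewrite (big_subgroups_cycle _ _ (s := [:: 1; 2; #[a]%g]%N)); first last.
  - by move=> d; rewrite oa4 dvdn_divisors.
  - by rewrite oa4.
  rewrite !big_cons big_nil cycle_sub_order /= addr0 addrA.
  rewrite card_gen_pairs1 ?card_cycle_sub ?dvd1n //.
  rewrite card_gen_pairs_prime ?card_cycle_sub //.
  by rewrite card_gen_pairs4 ?cycle_cyclic.
have p_odd : odd p by have [/eqP|//] := even_prime p_pr; rewrite (negPf pn2).
rewrite (big_subgroups_cycle _ _ (s := [:: 1; 2; p; #[a]%g]%N)); first last.
- by move=> d; rewrite oa dvdn_double_prime.
- by rewrite oa /= !inE; have := prime_gt1 p_pr; lia.
rewrite !big_cons big_nil cycle_sub_order /= addr0 !addrA.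
rewrite card_gen_pairs1 ?card_cycle_sub ?dvd1n //.
rewrite (@card_gen_pairs_prime _ (cycle_sub a 2)) ?card_cycle_sub //.
rewrite (@card_gen_pairs_prime _ (cycle_sub a p)) ?card_cycle_sub //.
by rewrite (card_gen_pairs_double_prime p_pr) ?cycle_cyclic.
Qed.

Lemma card_subgroups_dicyclic : #|subgroups G| = (p + 5 - (p == 2%N))%N.
Proof.
rewrite -sum1_card (dicyclic_sum (fun=> 1%N)) -mulr_natr mul1r natn.
by case: eqP => [->|_] //; rewrite -[LHS]/(4 + p + 1)%N; lia.
Qed.

End Dicyclic.

Theorem theorem4p3 (C : numClosedFieldType) (p : nat) (p_pr : prime p)
    (gT : finGroupType) (G : {group gT}) (G_Q4p : is_dicyclic p G) :
  (p = 2%N ->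
    [/\ energy C (sgb_graph G) = 2 + 14 * sqrtC 3 + 4 * sqrtC 6,
        laplacian_energy C (sgb_graph G) = 4132 / 35,
        signless_laplacian_energy C (sgb_graph G) = 4132 / 35
      & cn_energy C (sgb_graph G) = 116])
  /\
  ((3 <= p)%N ->
    [/\ energy C (sgb_graph G) =
          2 + 2 * sqrtC 3 + 2 * p%:R * sqrtC 12
          + 2 * sqrtC (p%:R ^+ 2 - 1) + 2 * sqrtC (3 * p%:R ^+ 2 - 3)
          + 2 * sqrtC (12 * p%:R ^+ 2 - 12 * p%:R),
        laplacian_energy C (sgb_graph G) =
          (512 * p%:R ^+ 4 + 2 * p%:R ^+ 2 + 20 * p%:R + 50)
          / (16 * p%:R ^+ 2 + p%:R + 5),
        signless_laplacian_energy C (sgb_graph G) =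
          (512 * p%:R ^+ 4 + 2 * p%:R ^+ 2 + 20 * p%:R + 50)
          / (16 * p%:R ^+ 2 + p%:R + 5)
      & cn_energy C (sgb_graph G) = 32 * p%:R ^+ 2 - 2 * p%:R - 10]).
Proof.
have gen2 := dicyclic_gen2 p_pr G_Q4p.
have [_ [_ [_ _ oG _]]] := dicyclic_structure p_pr G_Q4p.
rewrite sgb_laplacian_energy // sgb_signless_laplacian_energy //.
rewrite sgb_cn_energy // sgb_energy.
rewrite (dicyclic_sum p_pr G_Q4p (fun d => 2 * sqrtC d%:R)).
rewrite (card_subgroups_dicyclic p_pr G_Q4p) oG sqrtC1.
split=> [p2 | p_ge3].
  rewrite p2 /=.
  have [-> ->] : (2 + 5 - 1 = 6 /\ (4 * 2) ^ 2 + 6 = 70)%N by [].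
  rewrite (_ : 4 * 2 = 8)%N //.
  have s12 : sqrtC 12 = 2 * sqrtC 3 :> C.
    have -> : 12 = 2 ^+ 2 * 3 :> C by ring.
    by rewrite rootCMl ?exprn_ge0 ?ler0n // sqrCK ?ler0n.
  have s24 : sqrtC 24 = 2 * sqrtC 6 :> C.
    have -> : 24 = 2 ^+ 2 * 6 :> C by ring.
    by rewrite rootCMl ?exprn_ge0 ?ler0n // sqrCK ?ler0n.
  rewrite s12 s24; split; try ring.
  - by field.
  - by field.
have -> : (p == 2%N) = false by lia.
rewrite subn0; have p2_gt0 : (0 < p ^ 2)%N by rewrite expn_gt0; lia.
have -> : (p ^ 2 - 1)%:R = p%:R ^+ 2 - 1 :> C by rewrite natrB // natrX.
have -> : (3 * p ^ 2 - 3)%:R = 3 * p%:R ^+ 2 - 3 :> C.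
  by rewrite natrB ?natrM ?natrX //; lia.
have -> : (12 * p ^ 2 - 12 * p)%:R = 12 * p%:R ^+ 2 - 12 * p%:R :> C.
  by rewrite natrB ?natrM ?natrX //; nia.
have n0 : 16 * p%:R ^+ 2 + p%:R + 5 != 0 :> C.
  rewrite -natrX -natrM -!natrD pnatr_eq0; lia.
have dE : ((4 * p) ^ 2 + (p + 5))%:R = 16 * p%:R ^+ 2 + p%:R + 5 :> C.
  by rewrite !natrD natrX natrM; ring.
rewrite dE (natrD _ p 5) (natrM _ 4 p) -mulr_natr; split; try ring; by field.
Qed.
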